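(* Let $$f = \begin{pmatrix} t & 0 & 0 \\ 0 & 1 & 0 \\ 0 & 0 & t^{-1} \end{pmatrix} \quad\text{and}\quad k = \begin{pmatrix} 0 & -1 - t & -t^{-1} - 1 - t \\ 0 & t^{-1} + 1 + t & t^{-2} + t^{-1} + 1 + t \\ 1 & 0 & 0 \end{pmatrix},$$ regarded as elements of the group $\mathrm{SL}_3(\mathbb{Z}[t,t^{-1}])$. If $m$ and $n$ are integers with $m,n\ge 3$, then $f^m$ and $k^n$ generate a free group of rank $2$.
   Context: $\mathbb{Z}[t,t^{-1}]$ is the ring of Laurent polynomials in one indeterminate $t$ with integer coefficients. *)

(* Defs.v *)
From HB Require Import structures.
From mathcomp Require Import all_boot all_order all_algebra ring.
From mathcomp Require Import boolp classical_sets.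

Set Implicit Arguments.
Unset Strict Implicit.
Unset Printing Implicit Defensive.

Import GRing.Theory.

Local Open Scope classical_set_scope.
Local Open Scope ring_scope.

(* Z[t, t^-1], as the subring of the elements p / t^n of Frac(Z[t]). *)
Definition laurent_pred : {pred {fraction {poly int}}} :=
  [pred x | `[< exists (p : {poly int}) (n : nat),
                  x = tofrac p / tofrac 'X ^+ n >]].

Lemma laurent_predP (x : {fraction {poly int}}) :
  reflect (exists (p : {poly int}) (n : nat), x = tofrac p / tofrac 'X ^+ n)
          (x \in laurent_pred).
Proof. exact: asboolP. Qed.

Lemma tofracX_neq0 : tofrac ('X : {poly int}) != 0.
Proof. by rewrite tofrac_eq0 polyX_eq0. Qed.

Lemma laurent_subring_closed : subring_closed laurent_pred.
Proof.
have X0 n : tofrac ('X : {poly int}) ^+ n != 0 by rewrite expf_neq0 ?tofracX_neq0.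
split.
- by apply/laurent_predP; exists 1, 0%N; rewrite tofrac1 expr0 divr1.
- move=> _ _ /laurent_predP[p [n ->]] /laurent_predP[q [m ->]].
  apply/laurent_predP; exists (p * 'X^m - q * 'X^n), (n + m)%N.
  by rewrite -mulNr addf_div // -tofracN -!tofracXn -!tofracM -tofracD mulNr exprD.
- move=> _ _ /laurent_predP[p [n ->]] /laurent_predP[q [m ->]].
  apply/laurent_predP; exists (p * q), (n + m)%N.
  by rewrite mulf_div -tofracM exprD.
Qed.

Record laurent := Laurent {
  laurent_val :> {fraction {poly int}};
  _ : laurent_val \in laurent_pred }.

HB.instance Definition _ := [isSub for laurent_val].
HB.instance Definition _ := [Choice of laurent by <:].
HB.instance Definition _ :=
  GRing.SubChoice_isSubComNzRing.Build _ laurent_pred laurent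
    laurent_subring_closed.

Definition laurent_unit : {pred laurent} :=
  [pred x : laurent | (val x != 0) && ((val x)^-1 \in laurent_pred)].

(* Inversion takes place in Frac(Z[t]); like every MathComp inverse it is the
   identity outside the units. *)
Definition laurent_inv (x : laurent) : laurent :=
  if x \in laurent_unit then insubd x (val x)^-1 else x.

Fact laurent_mulVx : {in laurent_unit, left_inverse 1 laurent_inv *%R}.
Proof.
move=> x ux; apply: val_inj; rewrite /laurent_inv ux.
move: ux => /andP[x0 xV].
by rewrite rmorphM rmorph1 /= insubdK // mulVf.
Qed.

Fact laurent_unitPl (x y : laurent) : y * x = 1 -> laurent_unit x.
Proof.
move=> /(congr1 val); rewrite rmorphM rmorph1 /= => yx1.
have x0 : val x != 0.
  by apply: contra_eq_neq yx1 => ->; rewrite mulr0 eq_sym oner_neq0.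
rewrite /laurent_unit /= x0 /=.
by rewrite -[_^-1]mul1r -yx1 mulfK // (valP y).
Qed.

Fact laurent_invr_out : {in [predC laurent_unit], laurent_inv =1 id}.
Proof. by move=> x /negbTE ux; rewrite /laurent_inv ux. Qed.

HB.instance Definition _ :=
  GRing.ComNzRing_hasMulInverse.Build laurent
    laurent_mulVx laurent_unitPl laurent_invr_out.

Fact laurent_t_subproof : tofrac 'X \in laurent_pred.
Proof. by apply/laurent_predP; exists 'X, 0%N; rewrite expr0 divr1. Qed.

Definition laurent_t : laurent := Laurent laurent_t_subproof.

Lemma laurent_t_unit : laurent_t \is a GRing.unit.
Proof.
apply/andP; split; first exact: tofracX_neq0.
by apply/laurent_predP; exists 1, 1%N; rewrite tofrac1 div1r expr1.
Qed.

Section SpecialLinear.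
Variables (n : nat) (R : comNzRingType).

Record SL := MkSL { SL_val :> 'M[R]_n; _ : \det SL_val == 1 }.

HB.instance Definition _ := [isSub for SL_val].
HB.instance Definition _ := [Choice of SL by <:].

Implicit Types A B C : SL.

Lemma det_SL A : \det A = 1. Proof. exact: eqP (valP A). Qed.

Fact SL_one_subproof : \det (1%:M : 'M[R]_n) == 1.
Proof. by rewrite det1. Qed.

Fact SL_mul_subproof A B : \det (A *m B) == 1.
Proof. by rewrite det_mulmx !det_SL mulr1. Qed.

Fact SL_inv_subproof A : \det (\adj A) == 1.
Proof. by rewrite -[\det _]mul1r -(det_SL A) -det_mulmx mul_mx_adj det_SL det1. Qed.

Definition SL_one : SL := MkSL SL_one_subproof.
Definition SL_mul A B : SL := MkSL (SL_mul_subproof A B).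
Definition SL_inv A : SL := MkSL (SL_inv_subproof A).

Fact SL_mulA : associative SL_mul.
Proof. by move=> A B C; apply: val_inj; rewrite /= mulmxA. Qed.
Fact SL_mul1 : left_id SL_one SL_mul.
Proof. by move=> A; apply: val_inj; rewrite /= mul1mx. Qed.
Fact SL_mulr1 : right_id SL_one SL_mul.
Proof. by move=> A; apply: val_inj; rewrite /= mulmx1. Qed.
Fact SL_mulV : left_inverse SL_one SL_inv SL_mul.
Proof. by move=> A; apply: val_inj; rewrite /= mul_adj_mx det_SL. Qed.
Fact SL_mulrV : right_inverse SL_one SL_inv SL_mul.
Proof. by move=> A; apply: val_inj; rewrite /= mul_mx_adj det_SL. Qed.

HB.instance Definition _ :=
  isGroup.Build SL SL_mulA SL_mul1 SL_mulr1 SL_mulV SL_mulrV.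

End SpecialLinear.

Section GeneratedSubgroup.
Variables (G : groupType) (S : set G).

Definition generated : set G := smallest [set H : set G | group_closed [in H]] S.

Fact generated_group_closed : group_closed [in generated].
Proof.
split; first by apply/mem_set => H [[H1 _] _]; exact: set_mem.
move=> x y /set_mem gx /set_mem gy; apply/mem_set => H [[H1 HB] sSH].
by apply/set_mem/HB; apply/mem_set; [apply: gx | apply: gy].
Qed.

Record subgroup_gen := SubgroupGen {
  subgroup_gen_val :> G;
  _ : subgroup_gen_val \in generated }.

HB.instance Definition _ := [isSub for subgroup_gen_val].
HB.instance Definition _ := [Choice of subgroup_gen by <:].
HB.instance Definition _ :=
  SubChoice_isSubGroup.Build G [in generated] subgroup_gen
    generated_group_closed.

End GeneratedSubgroup.

(* The universal property of a free group with basis x. *)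
Definition free_on (I : Type) (F : groupType) (x : I -> F) : Prop :=
  forall (K : groupType) (y : I -> K),
    exists phi : {multiplicative F -> K},
      (forall i, phi (x i) = y i) /\
      (forall psi : {multiplicative F -> K},
         (forall i, psi (x i) = y i) -> psi =1 phi).

Definition free_of_rank (r : nat) (F : groupType) : Prop :=
  exists x : 'I_r -> F, free_on x.

Definition mx_of_rows (R : nzRingType) (m n : nat) (rows : seq (seq R)) :
  'M[R]_(m, n) := \matrix_(i < m, j < n) nth 0 (nth [::] rows i) j.

Local Notation t := laurent_t.

Definition f_mx : 'M[laurent]_3 := mx_of_rows 3 3
  [:: [:: t; 0; 0];
      [:: 0; 1; 0];
      [:: 0; 0; t^-1]].

Definition k_mx : 'M[laurent]_3 := mx_of_rows 3 3
  [:: [:: 0; - 1 - t; - t^-1 - 1 - t];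
      [:: 0; t^-1 + 1 + t; t ^- 2 + t^-1 + 1 + t];
      [:: 1; 0; 0]].

Fact det_f_mx : \det f_mx == 1.
Proof.
do 2!rewrite !(expand_det_row _ ord0) !big_ord_recl !big_ord0 /cofactor.
rewrite !det_mx11 !mxE /= /bump /=.
by have := mulrV laurent_t_unit => tV; apply/eqP; ring: tV.
Qed.

Fact det_k_mx : \det k_mx == 1.
Proof.
do 2!rewrite !(expand_det_row _ ord0) !big_ord_recl !big_ord0 /cofactor.
rewrite !det_mx11 !mxE /= /bump /= -exprVn.
by have := mulrV laurent_t_unit => tV; apply/eqP; ring: tV.
Qed.

Definition elt_f : SL 3 laurent := MkSL det_f_mx.
Definition elt_k : SL 3 laurent := MkSL det_k_mx.

(* Main.v *)
From HB Require Import structures.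
Require Import Defs.
From mathcomp Require Import all_boot all_order all_algebra.
From mathcomp Require Import boolp classical_sets.
From mathcomp Require Import ring zify.

(** The proof is a game of ping-pong played at the place [t = 0] of [Q(t)].

    Both [f] and [k] are diagonalizable over [Q(t)] with eigenvalues [t], [1]
    and [t^-1]. For the [t]-adic absolute value these have different sizes, so
    high powers of either matrix push almost all of [K^3] (with [K = Q(t)])
    close to the eigenline of [t^-1]. For [f] that line is spanned by
    [(0, 0, 1)]; for [k] it is spanned by [(t, -(1 + t^2), t^2)]. Being close to
    the first or the second line is made precise by the shapes
    [s (t^2 a, t b, 1 + t c)]  and  [s (t (1 + t a), -(1 + t b), t^2 (1 + t c))],
    with [a], [b], [c] polynomials and [s] a scalar ([f_cone], [k_cone]).

    Reversing the order of the coordinates, [flip], conjugates [f] to [f^-1]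
    and [k] to [k^-1] ([f_at_flip], [k_at_flip]). So the flipped cones play the
    same part for the inverses, and only positive powers have to be studied.
    The vector [(1, 1, 1)] is fixed by [flip] and lies in no cone. The heart of
    the matter is that, for an exponent at least 3, [f^m] sends [(1, 1, 1)] and
    every cone except the flipped [f_cone] into [f_cone], and likewise for
    [k^n] ([f_cone_attracts], [k_cone_attracts]). For [k] this comes from the
    explicit spectral decomposition of [k^n] ([k_atX]): the term in [t^-n]
    wins, because its coefficient is divisible by [t] at most once.

    It follows that a nonempty reduced word in [f^m] and [k^n] moves
    [(1, 1, 1)] into the cone of its first letter, and so is not the identity
    ([symmetric_ping_pong]). A family without nontrivial reduced relations has
    the universal property in the subgroup that it generates
    ([free_on_generated]): two words with the same value differ by relations
    that hold in all groups. *)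

Set Implicit Arguments.
Unset Strict Implicit.
Unset Printing Implicit Defensive.

Import GRing.Theory.

Local Open Scope classical_set_scope.

(** * Words, free families and ping-pong *)

Section Words.
Local Open Scope group_scope.
Variable I : choiceType.
Implicit Types (l : I * bool) (w : seq (I * bool)).

(** The letter [(i, true)] stands for the generator [i] and [(i, false)] for its
    inverse. *)
Definition inv_letter l := (l.1, ~~ l.2).

Definition letter_val (G : groupType) (x : I -> G) l :=
  if l.2 then x l.1 else (x l.1)^-1.

Definition word_val (G : groupType) (x : I -> G) w :=
  \prod_(l <- w) letter_val x l.

Definition reduced w := sorted (fun l l' => l' != inv_letter l) w.

Definition free_family (G : groupType) (x : I -> G) :=
  forall w, reduced w -> word_val x w = 1 -> w = [::].

Lemma letter_val_inv (G : groupType) (x : I -> G) l :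
  letter_val x (inv_letter l) = (letter_val x l)^-1.
Proof. by case: l => i []; rewrite /letter_val //= invgK. Qed.

Lemma word_val_cons (G : groupType) (x : I -> G) l w :
  word_val x (l :: w) = letter_val x l * word_val x w.
Proof. exact: big_cons. Qed.

Lemma word_val_cat (G : groupType) (x : I -> G) w w' :
  word_val x (w ++ w') = word_val x w * word_val x w'.
Proof. exact: big_cat. Qed.

Lemma word_val_inv (G : groupType) (x : I -> G) w :
  word_val x (rev (map inv_letter w)) = (word_val x w)^-1.
Proof.
rewrite /word_val -[w in RHS]revK -prodgV -map_rev big_map.
by apply: eq_bigr => l _; rewrite letter_val_inv.
Qed.

(** The reduced word is the same for all groups and all families [x]: this
    uniformity is what transports relations from one group to another. *)
Lemma ex_reduced_word w :
  exists2 w', reduced w' &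
    forall (G : groupType) (x : I -> G), word_val x w' = word_val x w.
Proof.
elim: w => [|l w [w' redw' valw']]; first by exists [::].
case: w' => [|l' w'] in redw' valw' *.
  by exists [:: l] => // G x; rewrite !word_val_cons valw'.
have [l'E|l'N] := eqVneq l' (inv_letter l).
  exists w'; first exact: path_sorted redw'.
  move=> G x; rewrite word_val_cons -valw' word_val_cons l'E letter_val_inv.
  by rewrite mulVKg.
exists [:: l, l' & w']; first by rewrite /reduced /= l'N.
by move=> G x; rewrite !(word_val_cons _ l) valw'.
Qed.

(** Reducing [w w'^-1] gives a word of value 1 at [x], hence the empty word; so
    [w w'^-1] has value 1 at every other family as well. *)
Lemma free_family_eq (G K : groupType) (x : I -> G) (y : I -> K) w w' :
  free_family x -> word_val x w = word_val x w' ->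
  word_val y w = word_val y w'.
Proof.
move=> xfree eqx.
have [v redv valv] := ex_reduced_word (w ++ rev (map inv_letter w')).
have v0 : v = [::].
  by apply: xfree => //; rewrite valv word_val_cat word_val_inv eqx mulgV.
have := valv K y; rewrite v0 /word_val big_nil -/(word_val _ _).
by rewrite word_val_cat word_val_inv => /esym/divg1_eq.
Qed.

Lemma gmulf_word_val (G K : groupType) (psi : {multiplicative G -> K})
    (x : I -> G) w :
  psi (word_val x w) = word_val (psi \o x) w.
Proof.
have psi1 : psi 1 = 1 by apply: (mulgI (psi 1)); rewrite -gmulfM !mulg1.
have psiM : {morph psi : g h / g * h} by exact: gmulfM.
have psiV g : psi g^-1 = (psi g)^-1.
  by apply/esym/mulg1_eq; rewrite -gmulfM mulgV.
rewrite /word_val (big_morph psi psiM psi1); apply: eq_bigr => l _.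
by rewrite /letter_val; case: l.2; rewrite ?psiV.
Qed.

(** The values of words form a subgroup containing [S], and [generated S] is
    the smallest one. *)
Lemma ex_word (G : groupType) (S : set G) (u : I -> subgroup_gen S)
    (g : subgroup_gen S) :
  S `<=` range (val \o u) -> exists w, word_val u w == g.
Proof.
move=> Su; suff [w gE] : exists w, word_val (val \o u) w = val g.
  by exists w; apply/eqP/val_inj; rewrite gmulf_word_val.
pose H : set G := [set h | exists w, word_val (val \o u) w = h].
apply: (set_mem (valP g) H); split=> /=.
  split; first by apply/mem_set; exists [::]; rewrite /word_val big_nil.
  move=> _ _ /set_mem[w <-] /set_mem[w' <-]; apply/mem_set.
  by exists (w ++ rev (map inv_letter w')); rewrite word_val_cat word_val_inv.
move=> h /Su[i _ <-]; exists [:: (i, true)].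
by rewrite word_val_cons /word_val big_nil mulg1.
Qed.

(** The morphism sends [g] to the value at [y] of a chosen word representing
    [g]; by [free_family_eq] the choice does not matter, which gives
    multiplicativity. *)
Lemma free_on_generated (G : groupType) (S : set G) (u : I -> subgroup_gen S) :
  S `<=` range (val \o u) ->
  free_family (val \o u) -> free_on u.
Proof.
move=> Su ufree K y.
pose word g := xchoose (ex_word g Su).
have wordK g : word_val u (word g) = g by apply/eqP/(xchooseP (ex_word g Su)).
have yE w : word_val y (word (word_val u w)) = word_val y w.
  by apply: (free_family_eq _ ufree); rewrite -!gmulf_word_val wordK.
have phiM : {morph (fun g => word_val y (word g)) : g h / g * h}.
  by move=> g h /=; rewrite -word_val_cat -[RHS]yE word_val_cat !wordK.
pose phi : {multiplicative subgroup_gen S -> K} :=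
  HB.pack (fun g => word_val y (word g)) (isMultiplicative.Build _ _ _ phiM).
exists phi; split=> [i|psi psiE g].
  have -> : u i = word_val u [:: (i, true)].
    by rewrite word_val_cons /word_val big_nil mulg1.
  by rewrite /= yE word_val_cons /word_val big_nil mulg1.
rewrite -{1}[g]wordK gmulf_word_val; congr (word_val _ _).
exact/funext/psiE.
Qed.

Section PingPong.
Variables (G : groupType) (T : Type) (act : G -> T -> T).
Hypothesis act1 : forall p, act 1 p = p.
Hypothesis actM : forall g h p, act (g * h) p = act g (act h p).

(** Ping-pong with one attracting set [C i] for each generator; that of
    [(x i)^-1] is the mirror image of [C i] under [J], because [J] conjugates
    the action of [x i] to that of its inverse. The letter [l] maps every
    attracting set into its own one, except that of [l^-1]. *)
Lemma symmetric_ping_pong (x : I -> G) (J : T -> T) (C : I -> set T) (p0 : T) :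
    involutive J ->
    (forall i p, act (x i) (J (act (x i) p)) = J p) ->
    J p0 = p0 ->
    (forall i, ~ C i p0) ->
    (forall i, C i (act (x i) p0)) ->
    (forall i j p, C j p -> C i (act (x i) p)) ->
    (forall i j p, i != j -> C j (J p) -> C i (act (x i) p)) ->
  free_family x.
Proof.
move=> JK xJx Jp0 Cp0 xp0 xC xJC.
pose D l p := C l.1 (if l.2 then p else J p).
have xVJ i p : J (act (x i)^-1 p) = act (x i) (J p).
  by rewrite -(xJx i) -(actM (x i)) mulgV act1.
have Dp0 l : ~ D l p0 by case: l => i []; rewrite /D /= ?Jp0; apply: Cp0.
have Dact0 l : D l (act (letter_val x l) p0).
  by case: l => i []; rewrite /D /letter_val /= ?xVJ ?Jp0.
have Dact l l' p : l' != inv_letter l -> D l' p -> D l (act (letter_val x l) p).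
  case: l l' => i [] [j []]; rewrite /D /letter_val /inv_letter /=.
  - by move=> _; apply: xC.
  - by rewrite xpair_eqE andbT eq_sym; apply: xJC.
  - by rewrite xpair_eqE andbT xVJ eq_sym => ij Cp; apply: xJC ij _; rewrite JK.
  - by move=> _; rewrite xVJ; apply: xC.
have Dword l w : reduced (l :: w) -> D l (act (word_val x (l :: w)) p0).
  elim: w l => [|l' w IHw] l; first by rewrite word_val_cons /word_val big_nil mulg1.
  rewrite /reduced /= => /andP[l'N redw]; rewrite word_val_cons actM.
  exact: Dact l'N (IHw _ redw).
case=> [|l w] // redw w1; case: (Dp0 l).
by have := Dword _ _ redw; rewrite w1 act1.
Qed.

End PingPong.
End Words.

(** * Columns of height 3 and powers of matrices *)

Section LinearAlgebra.
Local Open Scope ring_scope.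

Definition col3 (R : nzRingType) (a b c : R) : 'cV[R]_3 :=
  mx_of_rows 3 1 [:: [:: a]; [:: b]; [:: c]].

Lemma mulmx_col3 (R : nzRingType) (a11 a12 a13 a21 a22 a23 a31 a32 a33 a b c : R) :
  mx_of_rows 3 3 [:: [:: a11; a12; a13]; [:: a21; a22; a23]; [:: a31; a32; a33]]
    *m col3 a b c
  = col3 (a11 * a + a12 * b + a13 * c) (a21 * a + a22 * b + a23 * c)
         (a31 * a + a32 * b + a33 * c).
Proof.
apply/matrixP => i j; rewrite !mxE !big_ord_recl big_ord0 !mxE !ord1 /=.
by case: i => [[|[|[|?]]] ?] //=; rewrite addr0 addrA.
Qed.

Lemma col3D (R : nzRingType) (a b c a' b' c' : R) :
  col3 a b c + col3 a' b' c' = col3 (a + a') (b + b') (c + c').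
Proof.
by apply/matrixP => i j; rewrite !mxE ord1; case: i => [[|[|[|?]]] ?].
Qed.

Lemma col3Z (R : nzRingType) (s a b c : R) :
  s *: col3 a b c = col3 (s * a) (s * b) (s * c).
Proof.
by apply/matrixP => i j; rewrite !mxE ord1; case: i => [[|[|[|?]]] ?].
Qed.

Lemma mulmx_eigen (R : comNzRingType) n (M : 'M[R]_n.+1) (v : 'cV[R]_n.+1) s k :
  M *m v = s *: v -> M ^+ k *m v = s ^+ k *: v.
Proof.
move=> Mv; elim: k => [|k IHk]; first by rewrite mul1mx scale1r.
by rewrite exprSr -mulmxA Mv -scalemxAr IHk scalerA -exprS.
Qed.

(** Iterating the relation [M N M = N], which for an invertible [M] says that
    [N] conjugates [M^-1] to [M]. *)
Lemma mulmx_reverses (R : nzRingType) n (M N : 'M[R]_n.+1) k (v : 'cV_n.+1) :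
  (forall w : 'cV_n.+1, M *m (N *m (M *m w)) = N *m w) ->
  M ^+ k *m (N *m (M ^+ k *m v)) = N *m v.
Proof.
move=> MNM; elim: k => [|k IHk]; first by rewrite !mul1mx.
by rewrite {1}exprSr exprS -!mulmxA MNM.
Qed.

(** * The matrices [f] and [k] over a ring with a chosen unit *)

Section Matrices.
Variables (R : unitRingType) (t : R).

Definition f_at : 'M[R]_3 := mx_of_rows 3 3
  [:: [:: t; 0; 0];
      [:: 0; 1; 0];
      [:: 0; 0; t^-1]].

Definition k_at : 'M[R]_3 := mx_of_rows 3 3
  [:: [:: 0; - 1 - t; - t^-1 - 1 - t];
      [:: 0; t^-1 + 1 + t; t ^- 2 + t^-1 + 1 + t];
      [:: 1; 0; 0]].

End Matrices.

Section Specialization.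
Variables (R : unitRingType) (K : fieldType) (nu : {rmorphism R -> K}) (t : R).
Hypothesis t_unit : t \is a GRing.unit.

Lemma map_f_at : map_mx nu (f_at t) = f_at (nu t).
Proof.
apply/matrixP => i j; rewrite !mxE.
by case: i j => [[|[|[|?]]] ?] // [[|[|[|?]]] ?] //=;
  rewrite ?rmorphV ?rmorph1 ?rmorph0.
Qed.

Lemma map_k_at : map_mx nu (k_at t) = k_at (nu t).
Proof.
apply/matrixP => i j; rewrite !mxE.
by case: i j => [[|[|[|?]]] ?] // [[|[|[|?]]] ?] //=;
  rewrite -?exprVn ?(rmorphD, rmorphB, rmorphN, rmorphXn, rmorphV, rmorph1, rmorph0).
Qed.

End Specialization.

Section LinearAction.
Variables (n : nat) (R K : comNzRingType) (nu : {rmorphism R -> K}).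

Definition SL_act (g : SL n.+1 R) (v : 'cV[K]_n.+1) := map_mx nu (SL_val g) *m v.

Lemma SL_act1 v : SL_act 1%g v = v.
Proof. by rewrite /SL_act map_mx1 mul1mx. Qed.

Lemma SL_actM g h v : SL_act (g * h)%g v = SL_act g (SL_act h v).
Proof. by rewrite /SL_act map_mxM mulmxA. Qed.

Lemma SL_actX g k v : SL_act (g ^+ k)%g v = map_mx nu (SL_val g) ^+ k *m v.
Proof.
elim: k v => [|k IHk] v; first by rewrite SL_act1 mul1mx.
by rewrite expgS SL_actM IHk exprS -mulmxA.
Qed.

End LinearAction.

(** * Attracting cones *)

(** Only a few features of [Z[t]] inside [Q(t)] matter here: [A] plays the part
    of [Z[t]], and [x] that of [t]. That [x] is not a unit of [A] ensures that no element
    [1 + x a] is divisible by [x]. *)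
Section Dynamics.
Variables (A : comNzRingType) (K : fieldType) (iota : {rmorphism A -> K}) (x : A).
Local Notation t := (iota x).

Definition flip : 'M[K]_3 := mx_of_rows 3 3
  [:: [:: 0; 0; 1];
      [:: 0; 1; 0];
      [:: 1; 0; 0]].

(** The leading terms at [t = 0] are those of the eigenvectors of [f_at t] and
    [k_at t] for [t^-1], up to a common factor; for [f_at t] only lower bounds
    on the orders of the first two coordinates are kept. *)
Definition f_cone (v : 'cV[K]_3) := exists (s : K) (a b c : A),
  v = s *: col3 (iota (x ^+ 2 * a)) (iota (x * b)) (iota (1 + x * c)).

Definition k_cone (v : 'cV[K]_3) := exists (s : K) (a b c : A),
  v = s *: col3 (iota (x * (1 + x * a))) (iota (- (1 + x * b)))
                (iota (x ^+ 2 * (1 + x * c))).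

Hypothesis x_not_unit : forall a, x * a <> 1.
Hypothesis iota_inj : injective iota.
Hypothesis t_neq0 : t != 0.

Lemma flipE a b c : flip *m col3 a b c = col3 c b a.
Proof. by rewrite mulmx_col3; congr col3; ring. Qed.

Lemma col3_eta (v : 'cV[K]_3) : exists a b c, v = col3 a b c.
Proof.
exists (v 0 0), (v 1 0), (v (1 + 1) 0); apply/matrixP => i j; rewrite !mxE ord1.
by case: i => [[|[|[|?]]] ?] //=; congr (v _ _); apply: val_inj.
Qed.

Lemma flipK : involutive (mulmx flip : 'cV_3 -> 'cV_3).
Proof. by move=> v; have [a [b [c ->]]] := col3_eta v; rewrite !flipE. Qed.

Lemma f_at_flip (v : 'cV_3) : f_at t *m (flip *m (f_at t *m v)) = flip *m v.
Proof.
have [a [b [c ->]]] := col3_eta v.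
by rewrite !mulmx_col3; congr col3; field.
Qed.

Lemma k_at_flip (v : 'cV_3) : k_at t *m (flip *m (k_at t *m v)) = flip *m v.
Proof.
have [a [b [c ->]]] := col3_eta v.
by rewrite !mulmx_col3; congr col3; field.
Qed.

Lemma f_atX n a b c : f_at t ^+ n *m col3 a b c = col3 (t ^+ n * a) b (t ^- n * c).
Proof.
elim: n a b c => [|n IHn] a b c; first by rewrite mul1mx invr1 !mul1r.
rewrite exprSr -mulmxA mulmx_col3 IHn exprS invfM.
by congr col3; ring.
Qed.

Lemma onet_neq0 : 1 - t != 0.
Proof.
rewrite subr_eq0 -(rmorph1 iota) inj_eq //.
by apply/eqP => x1; apply: (x_not_unit (a := 1)); rewrite mulr1.
Qed.

(** The spectral decomposition of the powers of [k_at t]. The three columns are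
    right eigenvectors for [t], [1] and [t^-1], and the coefficients are the
    pairings of the vector with the left eigenvectors [(1, t, t)],
    [(1 + t^2, t + t^2, 1 + t^2)] and [(t, t, 1)]. *)
Lemma k_atX n y1 y2 y3 : k_at t ^+ n *m col3 y1 y2 y3 =
  ((1 - t) ^+ 2 * t)^-1 *:
    (- (t ^+ n * (y1 + t * y2 + t * y3)) *: col3 (t ^+ 2) (- (1 + t ^+ 2)) t
     + ((1 + t ^+ 2) * y1 + (t + t ^+ 2) * y2 + (1 + t ^+ 2) * y3)
         *: col3 t (- (1 + t)) t
     + - (t ^- n * (t * y1 + t * y2 + y3)) *: col3 t (- (1 + t ^+ 2)) (t ^+ 2)).
Proof.
have t1 := onet_neq0.
have eig_t : k_at t *m col3 (t ^+ 2) (- (1 + t ^+ 2)) t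
           = t *: col3 (t ^+ 2) (- (1 + t ^+ 2)) t.
  by rewrite mulmx_col3 col3Z; congr col3; field.
have eig_1 : k_at t *m col3 t (- (1 + t)) t = 1 *: col3 t (- (1 + t)) t.
  by rewrite mulmx_col3 col3Z; congr col3; field.
have eig_V : k_at t *m col3 t (- (1 + t ^+ 2)) (t ^+ 2)
           = t^-1 *: col3 t (- (1 + t ^+ 2)) (t ^+ 2).
  by rewrite mulmx_col3 col3Z; congr col3; field.
have yE : col3 y1 y2 y3 = ((1 - t) ^+ 2 * t)^-1 *:
    (- (y1 + t * y2 + t * y3) *: col3 (t ^+ 2) (- (1 + t ^+ 2)) t
     + ((1 + t ^+ 2) * y1 + (t + t ^+ 2) * y2 + (1 + t ^+ 2) * y3)
         *: col3 t (- (1 + t)) t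
     + - (t * y1 + t * y2 + y3) *: col3 t (- (1 + t ^+ 2)) (t ^+ 2)).
  by rewrite !(col3Z, col3D); congr col3; field; rewrite t1 t_neq0.
rewrite yE -scalemxAr !mulmxDr -!scalemxAr.
rewrite (mulmx_eigen _ eig_t) (mulmx_eigen _ eig_1) (mulmx_eigen _ eig_V).
rewrite expr1n scale1r !scalerA exprVn.
by rewrite !mulNr ![_ * t ^+ n]mulrC ![_ * t ^- n]mulrC.
Qed.

(** The pairing of the vector with the left eigenvector [(t, t, 1)] for [t^-1]
    is [t^j] times a factor that is a unit at [t = 0]. In [k^n] this term gets the weight
    [t^(j - n)], while the others get at least [1] and [t^n]. As
    [n - j >= 2] and [2 n - j >= 5], they only perturb the coordinates of the
    eigenvector [(t, -(1 + t^2), t^2)] within [k_cone]. *)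
Lemma k_atX_k_cone n s y1 y2 y3 (e d : A) j :
  (3 <= n)%N -> (j <= 1)%N -> e ^+ 2 = 1 ->
  x * y1 + x * y2 + y3 = e * x ^+ j * (1 + x * d) ->
  k_cone (k_at t ^+ n *m (s *: col3 (iota y1) (iota y2) (iota y3))).
Proof.
move=> n3 j1 e1 yE.
have [m nE] : exists m, n = (m + 2 + j)%N by exists (n - 2 - j)%N; lia.
have [p pE] : exists p, (m + 2 + n = p + 5)%N by exists (m + 2 + n - 5)%N; lia.
(* After division by the dominant weight, the vector is
   (1 + t d) (t, -(1 + t^2), t^2) - t^2 q (t, -(1 + t), t)
   + t^5 r (t^2, -(1 + t^2), t). *)
pose q := e * x ^+ m * ((1 + x ^+ 2) * y1 + (x + x ^+ 2) * y2 + (1 + x ^+ 2) * y3).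
pose r := e * x ^+ p * (y1 + x * y2 + x * y3).
exists (- (s * iota e * ((1 - t) ^+ 2 * t)^-1 * t ^- (m + 2))),
  (d - x * q + x ^+ 5 * r),
  (d + x + x ^+ 2 * d - x * q * (1 + x) + x ^+ 4 * r * (1 + x ^+ 2)),
  (d - q + x ^+ 3 * r).
have ie1 : iota e * iota e = 1 by rewrite -rmorphM -expr2 e1 rmorph1.
have iyE : t * iota y1 + t * iota y2 + iota y3 = iota e * t ^+ j * (1 + t * iota d).
  by have := congr1 iota yE; rewrite !(rmorphD, rmorphM, rmorphXn) rmorph1.
have tpE : t ^+ n = t ^- (m + 2) * t ^+ (p + 5).
  by rewrite -pE (exprD _ (m + 2)) mulKf ?expf_neq0.
have tjE : t ^- n * t ^+ j = t ^- (m + 2).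
  by rewrite nE (exprD _ (m + 2)) invfM mulfVK ?expf_neq0.
have tm0 : t ^- (m + 2) * t ^+ m * t ^+ 2 = 1.
  by rewrite -mulrA -exprD mulVf ?expf_neq0.
rewrite -scalemxAr k_atX iyE.
rewrite (_ : t ^- n * _ = iota e * (t ^- n * t ^+ j) * (1 + t * iota d));
  last by ring.
rewrite tjE tpE (exprD _ p).
move: (t ^- (m + 2)) tm0 => u um.
move: (_^-1) => D.
rewrite !(col3Z, col3D) /q /r.
have := rmorphXn iota m x; have := rmorphXn iota p x.
move: (x ^+ m) (x ^+ p) => xm xp ixp ixm; rewrite -ixp -{}ixm in um *.
by congr col3; ring: ie1 um.
Qed.

(** In each case the third coordinate, multiplied by [t^-n] with [n >= 3],
    becomes the largest one with the required margins. The flipped [f_cone] has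
    to be left out, since it contains eigenvectors of [f_at t] for [t]. *)
Lemma f_cone_attracts n (p : 'cV_3) : (3 <= n)%N ->
  [\/ p = col3 1 1 1, f_cone p, k_cone p | k_cone (flip *m p)] ->
  f_cone (f_at t ^+ n *m p).
Proof.
move=> n3.
have [w wE] : exists w, x ^+ n = x ^+ 3 * w.
  by exists (x ^+ (n - 3)); rewrite -exprD subnKC.
have iwE : t ^+ n = t ^+ 3 * iota w by rewrite -rmorphXn wE rmorphM rmorphXn.
have uw1 : t ^- n * t ^+ 3 * iota w = 1 by rewrite -mulrA -iwE mulVf ?expf_neq0.
case.
- move=> ->; rewrite f_atX.
  exists (t ^- n), (x ^+ 4 * w ^+ 2), (x ^+ 2 * w), 0.
  rewrite iwE in uw1 *; move: ((t ^+ 3 * _)^-1) uw1 => u uw1.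
  by rewrite !col3Z; congr col3; ring: uw1.
- move=> [s [a [b [c ->]]]]; rewrite -scalemxAr f_atX.
  exists (s * t ^- n), (x ^+ 6 * w ^+ 2 * a), (x ^+ 3 * w * b), c.
  rewrite iwE in uw1 *; move: ((t ^+ 3 * _)^-1) uw1 => u uw1.
  by rewrite !col3Z; congr col3; ring: uw1.
- move=> [s [a [b [c ->]]]]; rewrite -scalemxAr f_atX.
  exists (s * t ^- n * t ^+ 2), (x ^+ 3 * w ^+ 2 * (1 + x * a)),
    (- (w * (1 + x * b))), c.
  rewrite iwE in uw1 *; move: ((t ^+ 3 * _)^-1) uw1 => u uw1.
  by rewrite !col3Z; congr col3; ring: uw1.
- move=> [s [a [b [c pE]]]]; rewrite -[p]flipK pE -!scalemxAr flipE f_atX.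
  exists (s * t ^- n * t), (x ^+ 5 * w ^+ 2 * (1 + x * c)),
    (- (x * w * (1 + x * b))), a.
  rewrite iwE in uw1 *; move: ((t ^+ 3 * _)^-1) uw1 => u uw1.
  by rewrite !col3Z; congr col3; ring: uw1.
Qed.

(** For the four kinds of vectors, [t y1 + t y2 + y3] is [1 + t d], [-t (1 + t d)],
    [1 + t d] and [t (1 + t d)] respectively. *)
Lemma k_cone_attracts n (p : 'cV_3) : (3 <= n)%N ->
  [\/ p = col3 1 1 1, k_cone p, f_cone p | f_cone (flip *m p)] ->
  k_cone (k_at t ^+ n *m p).
Proof.
move=> n3; case.
- move=> ->; have := @k_atX_k_cone n 1 1 1 1 1 2%:R 0%N n3.
  by rewrite scale1r rmorph1; apply=> //; ring.
- move=> [s [a [b [c ->]]]].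
  by apply: (k_atX_k_cone s (e := -1) (d := b - (1 + x * a) - (1 + x * c))
    (j := 1)) => //; ring.
- move=> [s [a [b [c ->]]]].
  by apply: (k_atX_k_cone s (e := 1) (d := x ^+ 2 * a + x * b + c)
    (j := 0)) => //; ring.
- move=> [s [a [b [c pE]]]]; rewrite -[p]flipK pE -scalemxAr flipE.
  by apply: (k_atX_k_cone s (e := 1) (d := a + b + c) (j := 1)) => //; ring.
Qed.

(** Membership would give [x^2 a = 1 + x c], so that [x] would be a unit. *)
Lemma ones_notin_f_cone : ~ f_cone (col3 1 1 1).
Proof.
move=> [s [a [b [c /colP E]]]]; have := E ord_max; have := E 0.
rewrite !mxE /= => s1 s3.
have s0 : s != 0 by apply: contra_eq_neq s1 => ->; rewrite mul0r oner_neq0.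
have /iota_inj ac : iota (x ^+ 2 * a) = iota (1 + x * c).
  by apply: (mulfI s0); rewrite -s1.
by apply: (x_not_unit (a := x * a - c)); ring: ac.
Qed.

(** Membership would give [x (1 + x a) = - (1 + x b)], so that [x] would be a
    unit. *)
Lemma ones_notin_k_cone : ~ k_cone (col3 1 1 1).
Proof.
move=> [s [a [b [c /colP E]]]]; have := E 1; have := E 0.
rewrite !mxE /= => s1 s2.
have s0 : s != 0 by apply: contra_eq_neq s1 => ->; rewrite mul0r oner_neq0.
have /iota_inj ab : iota (x * (1 + x * a)) = iota (- (1 + x * b)).
  by apply: (mulfI s0); rewrite -s1.
apply: (x_not_unit (a := - (1 + x * a) - b)).
by rewrite mulrBr mulrN ab; ring.
Qed.

End Dynamics.

(** * Freeness of the powers of [f] and [k] *)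

Local Notation tf := (@tofrac {poly int}).
Local Notation act := (SL_act (val : {rmorphism laurent -> {fraction {poly int}}})).

Lemma act_fX m v : act (elt_f ^+ m)%g v = f_at (tf 'X) ^+ m *m v.
Proof. by rewrite SL_actX (map_f_at _ laurent_t_unit). Qed.

Lemma act_kX m v : act (elt_k ^+ m)%g v = k_at (tf 'X) ^+ m *m v.
Proof. by rewrite SL_actX (map_k_at _ laurent_t_unit). Qed.

Lemma polyX_not_unit (a : {poly int}) : 'X * a <> 1.
Proof. by move/(congr1 (horner^~ 0)); rewrite hornerM hornerX hornerC mul0r. Qed.

Lemma tofrac_inj : injective tf.
Proof. by move=> p q /eqP; rewrite tofrac_eq => /eqP. Qed.

Lemma fk_free m n : (3 <= m)%N -> (3 <= n)%N ->
  free_family (fun i : 'I_2 => if i == 0 then elt_f ^+ m else elt_k ^+ n)%g.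
Proof.
move=> m3 n3; have X0 := tofracX_neq0.
have f_attracts p := @f_cone_attracts _ _ tf 'X X0 m p m3.
have k_attracts p := @k_cone_attracts _ _ tf 'X polyX_not_unit tofrac_inj X0 n p n3.
pose C (i : 'I_2) := if i == 0 then f_cone tf 'X else k_cone tf 'X.
pose J : 'cV_3 -> 'cV_3 := mulmx (flip {fraction {poly int}}).
apply: (symmetric_ping_pong (act := act) (@SL_act1 _ _ _ _) (@SL_actM _ _ _ _)
  (J := J) (C := C) (p0 := col3 1 1 1)).
- exact: flipK.
- by move=> i p; case: ifP => _; rewrite ?act_fX ?act_kX;
    apply: mulmx_reverses => ?; [apply: f_at_flip | apply: k_at_flip].
- exact: flipE.
- move=> i; rewrite /C; case: ifP => _.
    exact: (ones_notin_f_cone polyX_not_unit tofrac_inj).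
  exact: (ones_notin_k_cone polyX_not_unit tofrac_inj).
- move=> i; rewrite /C; case: ifP => _; rewrite ?act_fX ?act_kX.
    by apply: f_attracts; constructor 1.
  by apply: k_attracts; constructor 1.
- move=> i j p; rewrite /C; case: (i == 0); case: (j == 0) => Cp.
  + by rewrite act_fX; apply: f_attracts; constructor 2.
  + by rewrite act_fX; apply: f_attracts; constructor 3.
  + by rewrite act_kX; apply: k_attracts; constructor 3.
  + by rewrite act_kX; apply: k_attracts; constructor 2.
- move=> i j p; rewrite /C.
  case: (eqVneq i 0) => i0; case: (eqVneq j 0) => j0 ij Cp.
  + by rewrite i0 j0 in ij.
  + by rewrite act_fX; apply: f_attracts; constructor 4.
  + by rewrite act_kX; apply: k_attracts; constructor 4.
  + by case: i j i0 j0 ij {Cp} => [[|[|?]] ?] [[|[|?]] ?].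
Qed.

End LinearAlgebra.

Theorem mainTheorem1 (m n : nat) (hm : (3 <= m)%N) (hn : (3 <= n)%N) :
  free_of_rank 2 (subgroup_gen [set (elt_f ^+ m)%g; (elt_k ^+ n)%g]).
Proof.
set S := [set _; _].
have memS (i : 'I_2) :
    (if i == 0%R then elt_f ^+ m else elt_k ^+ n)%g \in generated S.
  apply/mem_set => H [_ SH]; apply: SH.
  by case: ifP => _; [left | right].
exists (fun i => SubgroupGen (memS i)); apply: free_on_generated; last exact: fk_free.
by move=> _ [] ->; [exists (0%R : 'I_2) | exists (1%R : 'I_2)].
Qed.
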